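(* Let $a,b,c,d\in\mathbb{R}[z]$, let $f(t,z)$ be a real polynomial in $t$ and $z$, and define $$P(x,y,z)=-b(z)\,f\big(a(z)x+b(z)y,\,z\big)+c(z),\qquad Q(x,y,z)=a(z)\,f\big(a(z)x+b(z)y,\,z\big)+d(z).$$ Let $\lambda\in\mathbb{R}$, $\lambda\neq 0$, and $\gamma=1/\lambda$. Then the map $\lambda I+(P,Q,0):\mathbb{R}^3\to\mathbb{R}^3$ has inverse $\gamma I+(R,S,0)$, where $$R(x,y,z)=\gamma\, b(\gamma z)\, f\Big(\gamma\{a(\gamma z)x+b(\gamma z)y-a(\gamma z)c(\gamma z)-b(\gamma z)d(\gamma z)\},\,\gamma z\Big)-\gamma\, c(\gamma z),$$ $$S(x,y,z)=-\gamma\, a(\gamma z)\, f\Big(\gamma\{a(\gamma z)x+b(\gamma z)y-a(\gamma z)c(\gamma z)-b(\gamma z)d(\gamma z)\},\,\gamma z\Big)-\gamma\, d(\gamma z).$$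
   Context: $I$ denotes the identity map of $\mathbb{R}^3$, so that $\lambda I+(P,Q,0)$ is the map $(x,y,z)\mapsto(\lambda x+P(x,y,z),\lambda y+Q(x,y,z),\lambda z)$, and similarly for $\gamma I+(R,S,0)$. *)

(* Defs.v *)
(* MathComp; a realType plays the role of the field of real numbers. *)
From mathcomp Require Export all_boot all_order all_algebra.
From mathcomp Require Export reals.
From mathcomp Require Export mpoly.

Set Implicit Arguments.
Unset Strict Implicit.
Unset Printing Implicit Defensive.

Import GRing.Theory.
Local Open Scope ring_scope.

(* The indeterminates 'X_0 and 'X_1 of f stand for t and z, in this order. *)
Definition eval2 (R : realType) (f : {mpoly R[2]}) (t z : R) : R :=
  f.@[fun i : 'I_2 => [:: t; z]`_i].

Definition vec3 (R : realType) (x y z : R) : 'rV[R]_3 :=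
  \row_(i < 3) [:: x; y; z]`_i.

(* The map lambda I + (P, Q, 0) of R^3; the literals index columns in 'I_3. *)
Definition scaled_id_plus (R : realType) (lambda : R) (P Q : R -> R -> R -> R)
    (v : 'rV[R]_3) : 'rV[R]_3 :=
  let x := v 0 0 in let y := v 0 1 in let z := v 0 2 in
  lambda *: v + vec3 (P x y z) (Q x y z) 0.

(* Main.v *)
Require Import Defs.
From mathcomp Require Import ring.
Import GRing.Theory.
Local Open Scope ring_scope.

(** At a fixed height [z], the linear form [a(z) x + b(z) y] annihilates the
    direction [(- b(z), a(z))] along which [f] displaces a point.  So if
    [(X, Y, Z)] is the image of [(x, y, z)], then [Z = lambda z] and
    [a(z) X + b(z) Y = lambda (a(z) x + b(z) y) + a(z) c(z) + b(z) d(z)],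
    an identity in which [f] does not occur.  Both arguments of [f] can thus be
    read off the image: the second is [z = gamma Z], and the first is
    [gamma (a(z) X + b(z) Y - a(z) c(z) - b(z) d(z))].  The value of [f] being
    known, the equations for [X] and [Y] are solved for [x] and [y], and the
    solution is the map with [R] and [S].  Conversely, the same linear form
    evaluated on the image under that second map gives the argument at which
    [R] and [S] evaluate [f], so the two occurrences of [f] cancel in the other
    composite as well ([cancel_scaled_id_plus] reduces each composite to its
    first two coordinates). *)

Lemma vec3_eta (K : realType) (v : 'rV[K]_3) : v = vec3 (v 0 0) (v 0 1) (v 0 2).
Proof.
by apply/rowP => -[[|[|[|//]]] lt_i3]; rewrite mxE /=; congr (v _ _); apply/val_inj.
Qed.

Lemma scaled_id_plus_vec3 (K : realType) (l : K) (P Q : K -> K -> K -> K)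
    (x y z : K) :
  scaled_id_plus l P Q (vec3 x y z)
    = vec3 (l * x + P x y z) (l * y + Q x y z) (l * z).
Proof.
rewrite /scaled_id_plus; apply/rowP => -[[|[|[|//]]] lt_i3]; rewrite !mxE //=.
by rewrite addr0.
Qed.

Lemma cancel_scaled_id_plus (K : realType) (l m : K)
    (P Q R S : K -> K -> K -> K) :
  m * l = 1 ->
  (forall x y z,
     m * (l * x + P x y z) + R (l * x + P x y z) (l * y + Q x y z) (l * z) = x) ->
  (forall x y z,
     m * (l * y + Q x y z) + S (l * x + P x y z) (l * y + Q x y z) (l * z) = y) ->
  cancel (scaled_id_plus l P Q) (scaled_id_plus m R S).
Proof.
move=> ml1 eqx eqy v.
by rewrite [v]vec3_eta !scaled_id_plus_vec3 eqx eqy mulrA ml1 mul1r.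
Qed.

Theorem proposition2p9 (K : realType) (a b c d : {poly K}) (f : {mpoly K[2]})
    (lambda gamma : K) (hlambda : lambda != 0) (hgamma : gamma = 1 / lambda) :
  let P (x y z : K) : K :=
    - b.[z] * eval2 f (a.[z] * x + b.[z] * y) z + c.[z] in
  let Q (x y z : K) : K :=
    a.[z] * eval2 f (a.[z] * x + b.[z] * y) z + d.[z] in
  let R (x y z : K) : K :=
    gamma * b.[gamma * z]
      * eval2 f (gamma * (a.[gamma * z] * x + b.[gamma * z] * y
                          - a.[gamma * z] * c.[gamma * z]
                          - b.[gamma * z] * d.[gamma * z]))
                (gamma * z)
    - gamma * c.[gamma * z] in
  let S (x y z : K) : K :=
    - gamma * a.[gamma * z]
      * eval2 f (gamma * (a.[gamma * z] * x + b.[gamma * z] * y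
                          - a.[gamma * z] * c.[gamma * z]
                          - b.[gamma * z] * d.[gamma * z]))
                (gamma * z)
    - gamma * d.[gamma * z] in
  let F := scaled_id_plus lambda P Q in
  let G := scaled_id_plus gamma R S in
  cancel F G /\ cancel G F.
Proof.
move=> P Q R S F G.
have gl : gamma * lambda = 1 by rewrite hgamma mul1r mulVf.
have lg : lambda * gamma = 1 by rewrite mulrC.
(* Here [u] is any value of [f]: the first argument of [f] is recovered from
   the image of a point without knowing that value. *)
have form_recovered z x y u :
    gamma * (a.[z] * (lambda * x + (- b.[z] * u + c.[z]))
             + b.[z] * (lambda * y + (a.[z] * u + d.[z]))
             - a.[z] * c.[z] - b.[z] * d.[z]) = a.[z] * x + b.[z] * y.
  by ring: gl.
(* The height [w] stands for [gamma * z], and again [u] is any value of [f]. *)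
have form_matched w x y u :
    a.[w] * (gamma * x + (gamma * b.[w] * u - gamma * c.[w]))
    + b.[w] * (gamma * y + (- gamma * a.[w] * u - gamma * d.[w]))
      = gamma * (a.[w] * x + b.[w] * y - a.[w] * c.[w] - b.[w] * d.[w]).
  by ring.
split; apply: cancel_scaled_id_plus => // x y z; rewrite /P /Q /R /S.
- by rewrite mulrA gl mul1r form_recovered; ring: gl.
- by rewrite mulrA gl mul1r form_recovered; ring: gl.
- by rewrite form_matched; ring: lg.
- by rewrite form_matched; ring: lg.
Qed.
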